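(* Let $d$ be an odd positive integer with $d \equiv 2 \pmod 3$. Then $\chi(\mathbb{Z}^3, \sqrt{2d}) = 3$.
   Context: For $r>0$ and $S \subseteq \mathbb{R}^n$, $G(S,r)$ denotes the graph whose vertex set is $S$, two points $a,b$ being adjacent if and only if their Euclidean distance $|a-b|$ equals $r$; $\chi(S,r)$ denotes the chromatic number of $G(S,r)$. Here $\mathbb{Z}^3$ is the integer lattice in $\mathbb{R}^3$. *)

(* Defs.v *)
From HB Require Import structures.
From mathcomp Require Export all_boot all_order all_algebra.
From mathcomp Require Export all_classical reals.

Set Implicit Arguments.
Unset Strict Implicit.
Unset Printing Implicit Defensive.

Import Order.TTheory GRing.Theory Num.Theory.
Local Open Scope classical_set_scope.
Local Open Scope ring_scope.

Record graph := Graph { vertex : Type; adj : vertex -> vertex -> Prop }.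

Definition proper_coloring (G : graph) (C : Type) (c : vertex G -> C) : Prop :=
  forall a b : vertex G, adj a b -> c a <> c b.

Definition colorable (G : graph) (k : nat) : Prop :=
  exists c : vertex G -> 'I_k, proper_coloring c.

(* As a relation rather than a function, because a graph need not be
   colorable with finitely many colors. *)
Definition is_chromatic_number (G : graph) (k : nat) : Prop :=
  colorable G k /\ forall m : nat, colorable G m -> (k <= m)%N.

(* The library norm on row vectors is the sup norm, hence this definition. *)
Definition edist (R : realType) (n : nat) (a b : 'rV[R]_n) : R :=
  Num.sqrt (\sum_(i < n) (a ord0 i - b ord0 i) ^+ 2).

(* [set_type S] is the subtype of the points belonging to [S]. *)
Definition dist_graph (R : realType) (n : nat) (S : set 'rV[R]_n) (r : R) :
    graph :=
  @Graph (set_type S) (fun a b => edist (val a) (val b) = r).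

Definition int_lattice (R : realType) (n : nat) : set 'rV[R]_n :=
  [set v | forall i : 'I_n, v ord0 i \is a Num.int].
Arguments int_lattice : clear implicits.

(* Main.v *)
Require Import Defs.
From mathcomp Require Import all_boot all_order all_algebra.
From mathcomp Require Import all_classical reals.
From mathcomp Require Import zify ring.

(** Coloring a point by its coordinate sum modulo 3 is proper: as [2d] is [1]
    modulo 3, exactly one coordinate of an edge is nonzero modulo 3.

    If [x^2 + y^2 + z^2 = 2d] with [x] odd, a 2-coloring is invariant under
    translation by [2x] along each axis (compare the steps [(x, y, z)] and
    [(x, -y, -z)]).  With [s = x + y + z], which is even, three cyclically
    permuted steps translate by [(s, s, s)]; repeating this [x] times swaps the
    colors although each coordinate moves by a multiple of [2x].

    It remains to write [2d] as a sum of three squares, which is done by an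
    elementary class number relation.  Let [t n] count the [(x, y, z)] with
    [x^2 + y^2 + z^2 = n], [x] and [y] odd, [z] even, and let [c n] count the
    [(s, h, r)] with [2sh - r^2 = n], [|r| < min s h], [s] and [h] odd, [r] even;
    clearly [c (2k) > 0] for [k] odd.  For [m] odd, the sums over even [w] of
    [t (2m - w^2)] and [c (2m - w^2)] are [4 sigma m] and [sigma m], whence
    [t (2k) = 4 c (2k)] by induction on [k].

    The first sum is a quarter of the number of representations of [4m] by four
    odd squares.  This number is [16 sigma m] because both sides satisfy the
    recurrence expressing that the five coordinates of a sum of five odd squares
    are interchangeable; for [sigma] it is an identity between sums over
    [w^2 + 4de = M].

    The second sum counts the [(s, h, u, v)] with [sh + 2uv = m] and
    [|v - u| < min s h], where [w = u + v] and [r = v - u].  These are reduced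
    bases of sublattices of index [m] in [Z^2].  Two changes of basis, each a
    bijection between two regions, show that they are as numerous as the
    triangular bases, given by [u = 0] and [|v| < s], of which there are
    [sigma m]. *)

Set Implicit Arguments.
Unset Strict Implicit.
Unset Printing Implicit Defensive.
Import Order.TTheory GRing.Theory Num.Theory.
Local Open Scope ring_scope.

(** * Sums over boxes of integers *)

Definition oddz (n : int) : bool := odd `|n|%N.

Lemma oddzP n : reflect (exists k, n = 2 * k + 1) (oddz n).
Proof.
apply: (iffP idP) => [|[k ->]]; rewrite /oddz; last lia.
by exists (n %/ 2)%Z; lia.
Qed.

Lemma evenzP n : reflect (exists k, n = 2 * k) (~~ oddz n).
Proof.
apply: (iffP idP) => [|[k ->]]; rewrite /oddz; last lia.
by exists (n %/ 2)%Z; lia.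
Qed.

Lemma ler_mul_int (x y : int) : 0 < x -> 0 < y -> (x <= x * y) && (y <= x * y).
Proof. by move=> x0 y0; rewrite ler_pMr // ler_pMl // -!gtz0_ge1 x0 y0. Qed.

Lemma ler_abs_sqr (x : int) : `|x| <= x ^+ 2.
Proof. by nia. Qed.

Lemma sum_bij (V : nmodType) (I J : eqType) (r : seq I) (s : seq J)
    (P : pred I) (Q : pred J) (f : I -> J) (g : J -> I) (F : I -> V) (G : J -> V) :
  uniq r -> uniq s ->
  (forall x, P x -> F x != 0 -> x \in r) ->
  (forall y, Q y -> G y != 0 -> y \in s) ->
  (forall x, P x -> [/\ Q (f x), g (f x) = x & F x = G (f x)]) ->
  (forall y, Q y -> P (g y) /\ f (g y) = y) ->
  \sum_(x <- r | P x) F x = \sum_(y <- s | Q y) G y.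
Proof.
move=> ur us rF sG fP gQ.
have nonzero (T : Type) (t : seq T) (A : pred T) (H : T -> V) :
    \sum_(x <- t | A x) H x = \sum_(x <- t | A x && (H x != 0)) H x.
  by rewrite [RHS]big_mkcondr; apply: eq_bigr => x _; case: eqP.
rewrite nonzero [RHS]nonzero -big_filter -[RHS]big_filter.
rewrite [RHS](perm_big [seq f x | x <- r & P x && (F x != 0)]).
  by rewrite big_map !big_filter; apply: eq_bigr => x /andP[/fP[_ _ ->]].
apply: uniq_perm; first exact: filter_uniq.
  rewrite map_inj_in_uniq ?filter_uniq // => x y; rewrite !mem_filter.
  move=> /andP[/andP[/fP[_ fK _] _] _] /andP[/andP[/fP[_ fKy _] _] _].
  by move=> /(congr1 g); rewrite fK fKy.
move=> y; rewrite mem_filter; apply/andP/mapP => [[/andP[Qy Gy] _]|[x]].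
  have [Pg gK] := gQ y Qy; exists (g y) => //.
  have Fg : F (g y) != 0 by have [_ _ ->] := fP _ Pg; rewrite gK.
  by rewrite mem_filter Pg Fg rF.
rewrite mem_filter => /andP[/andP[/[dup] Px /fP[Qf _ FG] Fx] _] ->.
by rewrite -FG Fx Qf sG // -FG.
Qed.

Definition int_box (B : nat) : seq int := [seq i%:Z - B%:Z | i <- iota 0 (B + B + 1)].

Lemma mem_int_box B (x : int) : (x \in int_box B) = (`|x| <= B%:Z).
Proof.
apply/mapP/idP => [[i]|xB]; first by rewrite mem_iota; lia.
by exists `|(x + B%:Z)%R|%N; [rewrite mem_iota; lia | lia].
Qed.

Lemma int_box_uniq B : uniq (int_box B).
Proof. by rewrite map_inj_uniq ?iota_uniq // => i j; lia. Qed.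

Local Notation pairs r s := [seq (x, y) | x <- r, y <- s].

Lemma mem_pairs (I J : eqType) (r : seq I) (s : seq J) x y :
  ((x, y) \in pairs r s) = (x \in r) && (y \in s).
Proof. by apply/allpairsP/andP=> [[[? ?] [? ? []]]-> -> //|[? ?]]; exists (x, y). Qed.

Lemma pairs_uniq (I J : eqType) (r : seq I) (s : seq J) :
  uniq r -> uniq s -> uniq (pairs r s).
Proof. by move=> ur us; apply: allpairs_uniq => // -[? ?] [? ?] _ _. Qed.

Lemma sum_pairs (V : nmodType) (I J : Type) (r : seq I) (s : seq J) (P : pred I)
    (Q : pred J) (F : I -> J -> V) :
  \sum_(p <- pairs r s | P p.1 && Q p.2) F p.1 p.2 =
  \sum_(x <- r | P x) \sum_(y <- s | Q y) F x y.
Proof.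
rewrite big_mkcond big_allpairs [RHS]big_mkcond; apply: eq_bigr => x _ /=.
by case: (P x) => /=; [rewrite -big_mkcond | rewrite big1].
Qed.

(** * Sums of odd squares *)

Fixpoint square_sum_count (s : seq int) (k : nat) (n : int) : int :=
  if k is k'.+1 then \sum_(x <- s) square_sum_count s k' (n - x ^+ 2) else (n == 0)%:R.

(* All coordinates contribute the same amount to the total [n]. *)
Lemma square_sum_count_sqr s k n :
  k.+1%:R * \sum_(x <- s) x ^+ 2 * square_sum_count s k (n - x ^+ 2) =
  n * square_sum_count s k.+1 n.
Proof.
elim: k n => [|k IHk] n.
  rewrite mul1r mulr_sumr; apply: eq_bigr => x _ /=; have [E|] := eqVneq.
    by rewrite (subr0_eq E).
  by rewrite !mulr0.
have sqr_first : \sum_(x <- s) x ^+ 2 * square_sum_count s k.+1 (n - x ^+ 2) =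
    \sum_(x <- s) \sum_(y <- s) y ^+ 2 * square_sum_count s k (n - x ^+ 2 - y ^+ 2).
  rewrite exchange_big; apply: eq_bigr => x _ /=; rewrite mulr_sumr.
  by apply: eq_bigr => y _; congr (_ * square_sum_count _ _ _); ring.
rewrite -natr1 mulrDl mul1r {1}sqr_first mulr_sumr -big_split /=.
rewrite mulr_sumr; apply: eq_bigr => x _; rewrite IHk /=; ring.
Qed.

Corollary square_sum_count_recurrence s k n :
  \sum_(x <- s) (n - k.+1%:R * x ^+ 2) * square_sum_count s k (n - x ^+ 2) = 0.
Proof.
under eq_bigr do rewrite mulrBl -mulrA.
by rewrite sumrB -!mulr_sumr square_sum_count_sqr subrr.
Qed.

Local Notation triple := (int * (int * int))%type.
Local Notation quadruple := (int * int * (int * int))%type.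

(* The sums below range over the box [-B, B]; [B] only has to be so large that no
   nonzero term is left out. *)
Section Box.
Variable B : nat.
Local Notation box := (int_box B).
Local Notation odd_box := [seq w <- box | oddz w].
Local Notation box2 := (pairs box box).
Local Notation box3 := (pairs box box2).
Local Notation box4 := (pairs box2 box2).

Let box2_uniq : uniq box2. Proof. by rewrite !pairs_uniq ?int_box_uniq. Qed.
Let box3_uniq : uniq box3. Proof. by rewrite !pairs_uniq ?int_box_uniq. Qed.
Let box4_uniq : uniq box4. Proof. by rewrite !pairs_uniq ?int_box_uniq. Qed.

Lemma oddz_sqr_ge1 w : oddz w -> 1 <= w ^+ 2.
Proof. by rewrite /oddz => ow; nia. Qed.

Lemma square_sum_count_odd_lt k n : n < k%:Z -> square_sum_count odd_box k n = 0.
Proof.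
elim: k n => [|k IHk] n nk /=; first by rewrite lt_eqF.
by rewrite big_filter big1 // => w /oddz_sqr_ge1 w1; apply: IHk; lia.
Qed.

Lemma sum_odd_box_unit (V : nmodType) (f : int -> V) : (0 < B)%N ->
  (forall w, oddz w -> 1 < w ^+ 2 -> f w = 0) ->
  \sum_(w <- odd_box) f w = f 1 + f (-1).
Proof.
move=> B0 f0; rewrite big_filter.
have unit w : oddz w -> f w != 0 -> w = 1 \/ w = -1.
  move=> ow fw; have : ~ 1 < w ^+ 2 by move=> /(f0 w ow) E; rewrite E eqxx in fw.
  by have := oddz_sqr_ge1 ow; nia.
transitivity (\sum_(w <- [:: 1; -1] | oddz w) f w); last first.
  by rewrite !big_cons big_nil addr0.
apply: (sum_bij (f := id) (g := id)) => //; first exact: int_box_uniq.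
- by move=> w ow /(unit w ow)[] ->; rewrite mem_int_box; lia.
- by move=> w ow /(unit w ow)[] ->; rewrite !inE eqxx.
Qed.

Lemma square_sum_count_odd_min k : (0 < B)%N -> square_sum_count odd_box k k = 2 ^+ k.
Proof.
move=> B0; elim: k => //= k IHk; rewrite sum_odd_box_unit // => [|w ow w1]; last first.
  by apply: square_sum_count_odd_lt; lia.
by rewrite sqrrN expr1n (_ : k.+1%:Z - 1 = k) ?IHk; [rewrite exprS; ring | lia].
Qed.

(* If [f] vanishes on nonpositive numbers, the recurrence determines the values of
   [f] at the multiples of 4: its two largest arguments come from [w = 1] and
   [w = -1], with nonzero coefficient as soon as [K <> 1]. *)
Lemma odd_recurrence_eq0 (f : int -> int) (K : nat) : 4 * K%:Z + 1 <= B%:Z ->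
  (forall n, n <= 0 -> f n = 0) -> f 4 = 0 ->
  (forall k : int, 4 * k + 1 <= B%:Z -> \sum_(w <- odd_box)
     (4 * k + 1 - 5 * w ^+ 2) * f (4 * k + 1 - w ^+ 2) = 0) ->
  f (4 * K%:Z) = 0.
Proof.
move=> + f_le0 f4 recf; elim/ltn_ind: K => K IHK K_box.
have [K1|K1] := leqP K 1.
  by case: K K1 {IHK K_box} => [|[|//]] _; [exact: f_le0 | exact: f4].
have B0 : (0 < B)%N by lia.
have := recf K K_box; rewrite sum_odd_box_unit //.
  rewrite sqrrN expr1n addrK -mulrDl => /eqP; rewrite mulf_eq0.
  by case/orP=> [|/eqP //]; lia.
move=> w /oddzP[j ->] w1.
have -> : 4 * K%:Z + 1 - (2 * j + 1) ^+ 2 = 4 * (K%:Z - j * (j + 1)) by ring.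
have j0 : 0 < j * (j + 1) by nia.
have [Kj|Kj] := lerP (K%:Z - j * (j + 1)) 0; first by rewrite f_le0 ?mulr0 //; lia.
by rewrite -(gtz0_abs Kj) IHK ?mulr0 //; lia.
Qed.

(** * Zagier's substitution *)

Section Zagier.
Variable M : int.
Hypothesis M_box : M <= B%:Z.

Definition odd_triple (x : triple) : bool := let: (w, (d, e)) := x in
  [&& oddz w, oddz d, oddz e, 0 < d, 0 < e & w ^+ 2 + 4 * (d * e) == M].

Lemma odd_triple_box x : odd_triple x -> x \in box3.
Proof.
case: x => [w [d e]] /and5P[_ _ _ d0 /andP[e0 /eqP E]].
rewrite !mem_pairs !mem_int_box; have := ler_abs_sqr w; have := sqr_ge0 w.
by have := ler_mul_int d0 e0; lia.
Qed.

Lemma sum_odd_triple_bij (f g : triple -> triple) (C D : pred triple)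
    (F G : triple -> int) :
  (forall x, odd_triple x && C x ->
     [/\ odd_triple (f x) && D (f x), g (f x) = x & F x = G (f x)]) ->
  (forall y, odd_triple y && D y -> odd_triple (g y) && C (g y) /\ f (g y) = y) ->
  \sum_(x <- box3 | odd_triple x && C x) F x =
  \sum_(y <- box3 | odd_triple y && D y) G y.
Proof. by apply: sum_bij => // x /andP[/odd_triple_box]. Qed.

Definition triple_sum (F : int -> int -> int -> int) : int :=
  \sum_(x <- box3 | odd_triple x) F x.1 x.2.1 x.2.2.

Lemma triple_sumD F G :
  triple_sum (fun w d e => F w d e + G w d e) = triple_sum F + triple_sum G.
Proof. exact: big_split. Qed.

Lemma triple_sum_swap F : triple_sum F = triple_sum (fun w d e => F w e d).
Proof.
pose f (x : triple) := (x.1, (x.2.2, x.2.1)).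
apply: (sum_bij (f := f) (g := f)) => // [x /odd_triple_box //|x /odd_triple_box //||];
  by move=> [w [d e]]; rewrite /odd_triple /oddz /f /=; split=> //; lia.
Qed.

Lemma triple_sum_neg F : triple_sum F = triple_sum (fun w d e => F (- w) d e).
Proof.
pose f (x : triple) := (- x.1, x.2).
apply: (sum_bij (f := f) (g := f)) => // [x /odd_triple_box //|x /odd_triple_box //||];
  by move=> [w [d e]]; rewrite /odd_triple /oddz /f /= opprK; split=> //; lia.
Qed.

Lemma triple_sum_half :
  \sum_(x <- box3 | odd_triple x && (x.2.1 < x.2.2 + x.1)) (x.2.1 + x.2.2) * x.1 ^+ 2 =
  triple_sum (fun w d _ => d * w ^+ 2).
Proof.
have flip : \sum_(x <- box3 | odd_triple x && (x.2.1 < x.2.2 + x.1))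
      (x.2.1 + x.2.2) * x.1 ^+ 2 =
    \sum_(x <- box3 | odd_triple x && ~~ (x.2.1 < x.2.2 + x.1))
      (x.2.1 + x.2.2) * x.1 ^+ 2.
  pose f (x : triple) := (- x.1, (x.2.2, x.2.1)).
  apply: (sum_odd_triple_bij (f := f) (g := f)) => -[w [d e]].
    by rewrite /odd_triple /oddz /f /= opprK => wde; split=> //; [lia | ring].
  by rewrite /odd_triple /oddz /f /= opprK => wde; split=> //; lia.
have total : triple_sum (fun w d e => (d + e) * w ^+ 2) =
    triple_sum (fun w d _ => d * w ^+ 2) *+ 2.
  rewrite mulr2n {2}(triple_sum_swap (fun w d _ => d * w ^+ 2)) -triple_sumD.
  by apply: eq_bigr => x _; rewrite mulrDl.
apply/eqP; rewrite -(@eqr_pMn2r _ 2) // -total mulr2n {2}flip.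
by rewrite /triple_sum [eqbRHS](bigID (fun x => x.2.1 < x.2.2 + x.1)).
Qed.

(* The map [(w, d, e) |-> (w + 2 * d, d, e - w - d)] preserves [w ^+ 2 + 4 * (d * e)]
   but not the sign of [e]; Zagier's involution [(2 * e - w, w + d - e, e)] cancels
   the triples where it fails. *)
Lemma triple_sum_zagier :
  triple_sum (fun w d e => (e - w) * (w + 2 * d) ^+ 2) =
  triple_sum (fun w d _ => d * w ^+ 2).
Proof.
rewrite -triple_sum_half /triple_sum (bigID (fun x => x.1 + x.2.1 < x.2.2)) /=.
rewrite [X in _ + X](_ : _ = 0).
  rewrite addr0; pose f (x : triple) := (x.1 + 2 * x.2.1, (x.2.1, x.2.2 - x.1 - x.2.1)).
  pose g (x : triple) := (x.1 - 2 * x.2.1, (x.2.1, x.2.2 + x.1 - x.2.1)).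
  apply: (sum_odd_triple_bij (f := f) (g := g)) => -[w [d e]].
    rewrite /odd_triple /oddz /f /g /= => wde; split; first lia.
      by congr (_, (_, _)); ring.
    by congr (_ * _); ring.
  rewrite /odd_triple /oddz /f /g /= => wde; split; first lia.
  by congr (_, (_, _)); ring.
set S := LHS; suff : S = - S by lia.
rewrite -sumrN; pose f (x : triple) := (2 * x.2.2 - x.1, (x.1 + x.2.1 - x.2.2, x.2.2)).
apply: (sum_odd_triple_bij (f := f) (g := f)) => -[w [d e]].
  rewrite /odd_triple /oddz /f /= => wde; split; first lia.
    by congr (_, (_, _)); ring.
  by rewrite -mulNr; congr (_ * _ ^+ 2); ring.
rewrite /odd_triple /oddz /f /= => wde; split; first lia.
by congr (_, (_, _)); ring.
Qed.

Lemma triple_sum_eq0 : triple_sum (fun w d _ => d * (M - 5 * w ^+ 2)) = 0.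
Proof.
pose G w d e : int := (e - w) * (w + 2 * d) ^+ 2.
have sum_dw := triple_sum_swap (fun w d _ => d * w ^+ 2).
suff : 2 * triple_sum (fun w d _ => d * (M - 5 * w ^+ 2)) =
    triple_sum G + triple_sum (fun w d e => G (- w) d e) -
    2 * triple_sum (fun w _ e => e * w ^+ 2).
  rewrite -triple_sum_neg triple_sum_zagier -sum_dw.
  by rewrite -mulr2n [X in _ - X]mulr_natl subrr => /eqP; rewrite mulf_eq0 => /eqP.
rewrite /triple_sum !mulr_sumr -big_split -sumrB; apply: eq_bigr => -[w [d e]] /=.
by move=> /and5P[_ _ _ _ /andP[_ /eqP <-]]; rewrite /G; ring.
Qed.
End Zagier.

(** * Sums of four odd squares *)

Definition odd_sigma (n : int) : int :=
  \sum_(x <- box2 | [&& oddz x.1, oddz x.2, 0 < x.1, 0 < x.2 & x.1 * x.2 == n]) x.1.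

Lemma odd_sigma_le0 n : n <= 0 -> odd_sigma n = 0.
Proof.
move=> n0; apply: big1 => -[d e] /= /and5P[_ _ d0 e0 /eqP E].
by have := mulr_gt0 d0 e0; lia.
Qed.

Lemma odd_sigma1 : (0 < B)%N -> odd_sigma 1 = 1.
Proof.
move=> B0; transitivity (\sum_(x <- [:: (1, 1) : int * int] | x == (1, 1)) x.1).
  have unit (x : int * int) :
      [&& oddz x.1, oddz x.2, 0 < x.1, 0 < x.2 & x.1 * x.2 == 1] -> x = (1, 1).
    case: x => d e /and5P[/= _ _ d0 e0 /eqP E].
    by have := ler_mul_int d0 e0 => de; congr (_, _); lia.
  apply: (sum_bij (f := id) (g := id)) => // [x /unit -> _|x /eqP -> //|x|x /eqP -> //].
    by rewrite mem_pairs !mem_int_box; lia.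
  by move=> /unit ->.
by rewrite big_cons big_nil.
Qed.

Lemma odd_sigma_recurrence (k : int) : 4 * k + 1 <= B%:Z ->
  \sum_(w <- odd_box)
    (4 * k + 1 - 5 * w ^+ 2) * odd_sigma ((4 * k + 1 - w ^+ 2) %/ 4)%Z = 0.
Proof.
move=> k_box; rewrite -[RHS](triple_sum_eq0 k_box) [RHS]big_mkcond big_allpairs.
rewrite big_filter [LHS]big_mkcond; apply: eq_bigr => w _ /=.
case: ifP => [ow|_]; last by rewrite big1 // => -[d e].
have [j wE] := oddzP _ ow; rewrite -big_mkcond /odd_sigma mulr_sumr.
apply: eq_big => [[d e]|[d e] _ /=]; last by rewrite mulrC.
congr [&& _, _, _, _ & _].
have -> : 4 * k + 1 - w ^+ 2 = (k - j * (j + 1)) * 4 by rewrite wE; ring.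
by rewrite mulzK //; apply/eqP/eqP => /= E; [rewrite wE E|]; lia.
Qed.

Lemma square_sum_count4_odd_sigma (K : nat) : 4 * K%:Z + 1 <= B%:Z ->
  square_sum_count odd_box 4 (4 * K%:Z) = 16 * odd_sigma K.
Proof.
move=> K_box; pose f n := square_sum_count odd_box 4 n - 16 * odd_sigma (n %/ 4)%Z.
have : f (4 * K%:Z) = 0.
  apply: odd_recurrence_eq0 => // [n n0||k k_box].
  - by rewrite /f square_sum_count_odd_lt ?odd_sigma_le0 ?subrr; lia.
  - have B0 : (0 < B)%N by lia.
    by rewrite /f (square_sum_count_odd_min 4) // odd_sigma1.
  - under eq_bigr do rewrite /f mulrBr [_ * (16 * _)]mulrCA.
    by rewrite sumrB -mulr_sumr odd_sigma_recurrence // square_sum_count_recurrence.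
by rewrite /f mulKz // => /subr0_eq.
Qed.

Lemma sum_two_odd_squares (V : nmodType) (F : int -> V) :
  (forall n, B%:Z < n -> F n = 0) ->
  \sum_(a <- box | oddz a) \sum_(b <- box | oddz b) F (a ^+ 2 + b ^+ 2) =
  (\sum_(x <- box | oddz x) \sum_(y <- box | ~~ oddz y)
     F (2 * (x ^+ 2 + y ^+ 2))) *+ 2.
Proof.
move=> F0; have support n : F n != 0 -> n <= B%:Z.
  by move=> Fn; rewrite leNgt; apply: contraNN Fn => /F0 ->.
have sqr_box a b : F (a ^+ 2 + b ^+ 2) != 0 -> (a, b) \in box2.
  move=> /support; rewrite mem_pairs !mem_int_box.
  by have := ler_abs_sqr a; have := ler_abs_sqr b; have := normr_ge0 a; lia.
pose half_odd (p : int * int) := oddz ((p.1 + p.2) %/ 2)%Z.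
have flip : \sum_(p <- box2 | oddz p.1 && oddz p.2 && ~~ half_odd p)
      F (p.1 ^+ 2 + p.2 ^+ 2) =
    \sum_(p <- box2 | oddz p.1 && oddz p.2 && half_odd p) F (p.1 ^+ 2 + p.2 ^+ 2).
  pose f (p : int * int) := (p.1, - p.2).
  apply: (sum_bij (f := f) (g := f)) => // -[a b]; rewrite ?/half_odd /f /= ?opprK.
  - by move=> _ /sqr_box.
  - by move=> _ /sqr_box.
  - by rewrite /oddz sqrrN => odd_ab; split=> //; lia.
  - by rewrite /oddz => odd_ab; split=> //; lia.
rewrite -!sum_pairs (bigID half_odd) /= flip -mulr2n; congr (_ *+ 2); apply/esym.
pose f (q : int * int) := (q.1 + q.2, q.1 - q.2).
pose g (p : int * int) := (((p.1 + p.2) %/ 2)%Z, ((p.1 - p.2) %/ 2)%Z).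
apply: (sum_bij (f := f) (g := g)) => // -[x y]; rewrite ?/half_odd /f ?/g /=.
- rewrite (_ : 2 * _ = (x + y) ^+ 2 + (x - y) ^+ 2); last by ring.
  by move=> _ /sqr_box; rewrite !mem_pairs !mem_int_box; lia.
- by move=> _ /sqr_box.
- rewrite /oddz => odd_xy; split; [lia | congr (_, _); lia | congr F; ring].
- by rewrite /oddz => odd_ab; split; [lia | congr (_, _); lia].
Qed.

Definition ternary_count (n : int) : int :=
  \sum_(x <- box | oddz x) \sum_(y <- box | oddz y) \sum_(z <- box | ~~ oddz z)
    (x ^+ 2 + y ^+ 2 + z ^+ 2 == n)%:R.

Lemma square_sum_count4_ternary m : 4 * m <= B%:Z ->
  square_sum_count odd_box 4 (4 * m) =
  4 * \sum_(w <- box | ~~ oddz w) ternary_count (2 * m - w ^+ 2).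
Proof.
move=> m_box.
transitivity (\sum_(a <- box | oddz a) \sum_(b <- box | oddz b)
    \sum_(c <- box | oddz c) \sum_(d <- box | oddz d)
    (a ^+ 2 + b ^+ 2 + (c ^+ 2 + d ^+ 2) == 4 * m)%:R : int).
  rewrite /= big_filter; apply: eq_bigr => a _; rewrite big_filter.
  apply: eq_bigr => b _; rewrite big_filter; apply: eq_bigr => c _.
  by rewrite big_filter; apply: eq_bigr => d _; congr (_ %:R); lia.
rewrite (sum_two_odd_squares (F := fun n => \sum_(c <- box | oddz c)
  \sum_(d <- box | oddz d) (n + (c ^+ 2 + d ^+ 2) == 4 * m)%:R)); last first.
  move=> n nB; rewrite big1 // => c _; rewrite big1 // => d _.
  by have := sqr_ge0 c; have := sqr_ge0 d; case: eqP => //; lia.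
rewrite [RHS]mulr_natl [in RHS]exchange_big [RHS](mulrnA _ 2 2) /=; congr (_ *+ 2).
rewrite -sumrMnl; apply: eq_bigr => x _; rewrite -sumrMnl; apply: eq_bigr => w _.
rewrite (sum_two_odd_squares (F := fun n => (2 * (x ^+ 2 + w ^+ 2) + n == 4 * m)%:R)).
  by congr (_ *+ 2); do 2![apply: eq_bigr => ? _]; congr (_ %:R); lia.
by move=> n nB; have := sqr_ge0 x; have := sqr_ge0 w; case: eqP => //; lia.
Qed.

(** * Reduced lattice bases *)

Section Bases.
Variable m : int.
Hypothesis m_box : m <= B%:Z.

(* [((s, h), (u, v))] stands for the basis [(s, -2u)], [(v, h)] of a sublattice of
   [Z^2] of index [m]. *)
Definition basis (x : quadruple) : bool :=
  let: ((s, h), (u, v)) := x in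
  [&& 0 < s, oddz s, oddz h, ~~ oddz (v - u) & s * h + 2 * (u * v) == m].

Definition nbasis (C : pred quadruple) : int :=
  \sum_(x <- box4 | basis x) (C x)%:Z.

Lemma nbasisE C : nbasis C = \sum_(x <- box4 | basis x && C x) 1.
Proof. by rewrite big_mkcondr; apply: eq_bigr => x _; case: (C x). Qed.

Lemma nbasisU (C D E : pred quadruple) :
  (forall x, basis x -> C x = (D x + E x)%N :> nat) -> nbasis C = nbasis D + nbasis E.
Proof.
by move=> CDE; rewrite -big_split; apply: eq_bigr => x /CDE ->; rewrite PoszD.
Qed.

Lemma nbasis_sign (C : pred quadruple) :
  nbasis C = nbasis (fun x => C x && (x.2.1 < 0)) +
    nbasis (fun x => C x && (x.2.1 == 0)) + nbasis (fun x => C x && (0 < x.2.1)).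
Proof.
rewrite -!big_split; apply: eq_bigr => -[[s h] [u v]] _ /=.
by case: (C _) => //=; case: ltrgt0P.
Qed.

Lemma nbasis_bij (f g : quadruple -> quadruple) (C D : pred quadruple) :
  (forall x, basis x -> C x -> x \in box4) ->
  (forall y, basis y -> D y -> y \in box4) ->
  (forall x, basis x -> C x -> [/\ basis (f x), D (f x) & g (f x) = x]) ->
  (forall y, basis y -> D y -> [/\ basis (g y), C (g y) & f (g y) = y]) ->
  nbasis C = nbasis D.
Proof.
move=> C_box D_box fP gP; rewrite !nbasisE; apply: (sum_bij (f := f) (g := g)) => //.
- by move=> x /andP[bx Cx] _; apply: C_box.
- by move=> y /andP[yb Dy] _; apply: D_box.
- by move=> x /andP[bx Cx]; have [-> -> ->] := fP x bx Cx.
- by move=> y /andP[yb Dy]; have [-> -> ->] := gP y yb Dy.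
Qed.

Definition shearable (x : quadruple) : bool :=
  let: ((s, h), (u, v)) := x in [&& 0 < u, s < v - u & - h < 2 * u].

Definition sheared (x : quadruple) : bool :=
  let: ((s, h), (u, v)) := x in [&& 0 < u, u - v < s & 2 * u < h].

Definition turnable (x : quadruple) : bool :=
  let: ((s, h), (u, v)) := x in [&& 0 < h, - h < 2 * u, h < v - u & v - u < s].

Definition turned (x : quadruple) : bool :=
  let: ((s, h), (u, v)) := x in
  (`|h| < 2 * u) &&
    ((h < 0) && (s < v - u) || [&& 0 < h, u - v < s & u - v < h]).

Definition reduced (x : quadruple) : bool :=
  let: ((s, h), (u, v)) := x in (`|v - u| < s) && (`|v - u| < h).

Definition positive (x : quadruple) : bool :=
  let: ((s, h), (u, v)) := x in [&& 0 < h, 0 < u, u - v < s & u - v < h].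

Definition triangular (x : quadruple) : bool :=
  let: ((s, h), (u, v)) := x in [&& u == 0, 0 < h & `|v| < s].

Definition mirror (x : quadruple) := (x.1, (- x.2.1, - x.2.2)).

Lemma mem_mirror x : (mirror x \in box4) = (x \in box4).
Proof. by case: x => [[s h] [u v]]; rewrite !mem_pairs !mem_int_box !normrN. Qed.

Lemma mirrorK : involutive mirror.
Proof. by case=> [[s h] [u v]]; rewrite /mirror /= !opprK. Qed.

Lemma basis_mirror x : basis (mirror x) = basis x.
Proof. by case: x => [[s h] [u v]]; rewrite /basis /oddz /= mulrNN; lia. Qed.

Lemma shearable_box x : basis x -> shearable x -> x \in box4.
Proof.
case: x => [[s h] [u v]] /and5P[s0 _ _ _ /eqP E] /and3P[u0 sv hu].
have h'0 : 0 < h + 2 * u by lia.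
have v'0 : 0 < v - s by lia.
have Em : s * (h + 2 * u) + 2 * (u * (v - s)) = m by rewrite -E; ring.
have := ler_mul_int s0 h'0; have := ler_mul_int u0 v'0.
by rewrite !mem_pairs !mem_int_box; lia.
Qed.

Lemma sheared_box x : basis x -> sheared x -> x \in box4.
Proof.
case: x => [[s h] [u v]] /and5P[s0 _ _ _ /eqP E] /and3P[u0 sv hu].
have h'0 : 0 < h - 2 * u by lia.
have v'0 : 0 < v + s by lia.
have Em : s * (h - 2 * u) + 2 * (u * (v + s)) = m by rewrite -E; ring.
have := ler_mul_int s0 h'0; have := ler_mul_int u0 v'0.
by rewrite !mem_pairs !mem_int_box; lia.
Qed.

Lemma positive_box x : basis x -> positive x -> x \in box4.
Proof.
case: x => [[s h] [u v]] /and5P[s0 _ _ _ /eqP E] /and4P[h0 u0 uvs uvh].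
rewrite !mem_pairs !mem_int_box; have sh := ler_mul_int s0 h0.
have [v0|v0] := ltrP 0 v; first by have := ler_mul_int u0 v0; lia.
have s'0 : 0 < s - (u - v) by lia.
have h'0 : 0 < h - (u - v) by lia.
have uv0 : 0 < u - v by lia.
have Em : (s - (u - v)) * (h - (u - v)) + (s - (u - v)) * (u - v) +
  (h - (u - v)) * (u - v) + u ^+ 2 + v ^+ 2 = m by rewrite -E; ring.
have := ler_mul_int s'0 h'0; have := ler_mul_int s'0 uv0; have := ler_mul_int h'0 uv0.
by have := sqr_ge0 u; have := sqr_ge0 v; lia.
Qed.

Lemma triangular_box x : basis x -> triangular x -> x \in box4.
Proof.
case: x => [[s h] [u v]] /and5P[s0 _ _ _ /eqP E] /and3P[/eqP u0 h0 vs].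
rewrite !mem_pairs !mem_int_box; have := ler_mul_int s0 h0.
by move: E; rewrite u0 mul0r mulr0 addr0 => ->; lia.
Qed.

Lemma turnable_box x : basis x -> turnable x -> x \in box4.
Proof.
case: x => [[s h] [u v]] bx /and4P[h0 hu hv vs].
have [u0|u0|u0] := ltrgt0P u; last 1 first.
- by apply: triangular_box => //; rewrite /triangular; lia.
- by apply: positive_box => //; rewrite /positive; lia.
rewrite -mem_mirror; apply: sheared_box; first by rewrite basis_mirror.
by rewrite /sheared /=; lia.
Qed.

Lemma turned_box x : basis x -> turned x -> x \in box4.
Proof.
case: x => [[s h] [u v]] bx /andP[hu /orP[/andP[h0 sv]|/and3P[h0 uvs uvh]]].
  by apply: shearable_box => //; rewrite /shearable; lia.
by apply: positive_box => //; rewrite /positive; lia.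
Qed.

(* The change of basis [(l1, l2) |-> (l1, l2 - 2 l1)]. *)
Lemma nbasis_shear : nbasis shearable = nbasis sheared.
Proof.
pose f (x : quadruple) := ((x.1.1, x.1.2 + 4 * x.2.1), (x.2.1, x.2.2 - 2 * x.1.1)).
pose g (x : quadruple) := ((x.1.1, x.1.2 - 4 * x.2.1), (x.2.1, x.2.2 + 2 * x.1.1)).
apply: (nbasis_bij (f := f) (g := g)).
- exact: shearable_box.
- exact: sheared_box.
- move=> [[s h] [u v]]; rewrite /basis /shearable /sheared /oddz /f /g /= => bx sx.
  by split; [lia | lia | congr ((_, _), (_, _)); ring].
- move=> [[s h] [u v]]; rewrite /basis /shearable /sheared /oddz /f /g /= => bx sx.
  by split; [lia | lia | congr ((_, _), (_, _)); ring].
Qed.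

(* The change of basis [(l1, l2) |-> (l1 - 2 l2, l1 - l2)], followed if [s <= 2 * v]
   by a sign change and [mirror]. *)
Definition turn (x : quadruple) : quadruple :=
  let: ((s, h), (u, v)) := x in
  if 2 * v < s then ((s - 2 * v, - h - 2 * u), (h + u, s - v))
  else ((2 * v - s, h + 2 * u), (h + u, s - v)).

Definition unturn (y : quadruple) : quadruple :=
  let: ((s, h), (u, v)) := y in
  if h < 0 then ((2 * v - s, 2 * u + h), (- h - u, v - s))
  else ((2 * v + s, 2 * u - h), (h - u, v + s)).

Lemma nbasis_turn : nbasis turnable = nbasis turned.
Proof.
apply: (nbasis_bij (f := turn) (g := unturn)).
- exact: turnable_box.
- exact: turned_box.
- move=> [[s h] [u v]]; rewrite /basis /turnable /turned /oddz /turn /unturn => bx tx.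
  have [sv|sv] := ltrP (2 * v) s; (split; [lia | lia | ]).
    by rewrite ifT; [congr ((_, _), (_, _)); lia | lia].
  by rewrite ifF; [congr ((_, _), (_, _)); lia | lia].
- move=> [[s h] [u v]]; rewrite /basis /turnable /turned /oddz /turn /unturn => bx tx.
  have [h0|h0] := ltrP h 0; (split; [lia | lia | ]).
    by rewrite ifT; [congr ((_, _), (_, _)); lia | lia].
  by rewrite ifF; [congr ((_, _), (_, _)); lia | lia].
Qed.

Lemma nbasis_mirror (C : pred quadruple) :
  (forall x, basis x -> C x -> x \in box4) -> nbasis (C \o mirror) = nbasis C.
Proof.
move=> C_box; apply: (nbasis_bij (f := mirror) (g := mirror)) => // x bx Cx.
- by rewrite -mem_mirror C_box ?basis_mirror.
- by rewrite basis_mirror mirrorK.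
- by rewrite basis_mirror /comp mirrorK.
Qed.

(* The regions [shearable] and [turnable] together are as numerous as [sheared] and
   [turned]; what remains after canceling their common parts is the claim. *)
Lemma nbasis_reduced_pos :
  nbasis (fun x => reduced x && (0 < x.2.1)) =
  nbasis (fun x => turnable x && (x.2.1 == 0)).
Proof.
pose shearable_pos x := shearable x && (0 < x.1.2).
pose shearable_neg x := shearable x && (x.1.2 < 0).
pose turnable_pos x := turnable x && (0 < x.2.1).
pose turnable_neg x := turnable x && (x.2.1 < 0).
pose turned_pos x := turned x && (0 < x.1.2).
pose sheared_pos x := sheared x && positive x.
pose nonreduced x := positive x && ~~ reduced x.
have neg_mirror : nbasis (turnable_neg \o mirror) = nbasis turnable_neg.
  by apply: nbasis_mirror => x bx /andP[/(turnable_box bx)].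
have shearableU : nbasis shearable = nbasis shearable_pos + nbasis shearable_neg.
  apply: nbasisU => -[[s h] [u v]].
  by rewrite /basis /shearable_pos /shearable_neg /shearable /oddz /=; lia.
have turnedU : nbasis turned = nbasis turned_pos + nbasis shearable_neg.
  apply: nbasisU => -[[s h] [u v]].
  by rewrite /basis /turned_pos /shearable_neg /shearable /turned /oddz /=; lia.
have shearedU :
    nbasis sheared = nbasis sheared_pos + nbasis (turnable_neg \o mirror).
  apply: nbasisU => -[[s h] [u v]].
  rewrite /basis /sheared_pos /turnable_neg /positive /turnable /sheared.
  by rewrite /oddz /=; lia.
have positiveU : nbasis positive = nbasis turned_pos + nbasis sheared_pos.
  apply: nbasisU => -[[s h] [u v]].
  by rewrite /basis /turned_pos /sheared_pos /positive /turned /sheared /oddz /=; lia.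
have positive_reducedU : nbasis positive =
    nbasis (fun x => reduced x && (0 < x.2.1)) + nbasis nonreduced.
  apply: nbasisU => -[[s h] [u v]].
  by rewrite /basis /nonreduced /reduced /positive /oddz /=; lia.
have nonreducedU : nbasis nonreduced = nbasis shearable_pos + nbasis turnable_pos.
  apply: nbasisU => -[[s h] [u v]].
  rewrite /basis /nonreduced /reduced /positive /shearable_pos /turnable_pos.
  by rewrite /shearable /turnable /oddz /=; lia.
have := nbasis_sign turnable; rewrite -/turnable_neg -/turnable_pos.
by have := nbasis_shear; have := nbasis_turn; lia.
Qed.

Lemma reduced_box x : basis x -> reduced x -> x \in box4.
Proof.
case: x => [[s h] [u v]] bx /andP[uvs uvh]; have h0 : 0 < h by lia.
have [u0|u0|u0] := ltrgt0P u.
- by apply: positive_box => //; rewrite /positive; lia.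
- rewrite -mem_mirror; apply: positive_box; first by rewrite basis_mirror.
  by rewrite /positive /=; lia.
- by apply: triangular_box => //; rewrite /triangular; lia.
Qed.

Lemma nbasis_reduced : nbasis reduced = nbasis triangular.
Proof.
pose pos x := reduced x && (0 < x.2.1); pose neg x := reduced x && (x.2.1 < 0).
pose zero x := turnable x && (x.2.1 == 0).
pose nonreduced x := triangular x && ~~ reduced x.
have neg_mirror : nbasis (neg \o mirror) = nbasis neg.
  by apply: nbasis_mirror => x bx /andP[/(reduced_box bx)].
have zero_mirror : nbasis (zero \o mirror) = nbasis zero.
  by apply: nbasis_mirror => x bx /andP[/(turnable_box bx)].
have pos_neg : nbasis pos = nbasis (neg \o mirror).
  apply: eq_bigr => -[[s h] [u v]] _; rewrite /pos /neg /reduced /mirror /=.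
  by lia.
have triangularU : nbasis triangular =
    nbasis (fun x => reduced x && (x.2.1 == 0)) + nbasis nonreduced.
  apply: nbasisU => -[[s h] [u v]].
  by rewrite /basis /nonreduced /triangular /reduced /oddz /=; lia.
have nonreducedU : nbasis nonreduced = nbasis zero + nbasis (zero \o mirror).
  apply: nbasisU => -[[s h] [u v]].
  rewrite /basis /nonreduced /zero /mirror /turnable /triangular /reduced.
  by rewrite /oddz /=; lia.
have := nbasis_sign reduced; rewrite -/neg -/pos.
by have := nbasis_reduced_pos; rewrite -/zero -/pos; lia.
Qed.

Lemma count_even_lt s : 0 < s -> oddz s -> s <= B%:Z ->
  \sum_(v <- box | ~~ oddz v && (`|v| < s)) 1 = s.
Proof.
move=> s0 os sB; have [K sE] : exists K : nat, s = 2 * K%:Z + 1.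
  by exists `|s|./2; move: os; rewrite /oddz; lia.
transitivity (\sum_(w <- int_box K | w \in int_box K) 1 : int).
  apply: (sum_bij (f := fun v => (v %/ 2)%Z) (g := fun w => 2 * w));
    rewrite ?int_box_uniq //.
  - by move=> v v_lt _; rewrite mem_int_box; lia.
  - by move=> v; rewrite mem_int_box /oddz => v_lt; split=> //; lia.
  - by move=> w; rewrite mem_int_box /oddz => w_le; split; lia.
rewrite -big_seq big_const_seq count_predT size_map size_iota iter_addr_0 natz.
by rewrite sE; lia.
Qed.

Lemma nbasis_triangular : nbasis triangular = odd_sigma m.
Proof.
rewrite /nbasis big_mkcond big_allpairs [RHS]big_mkcond.
apply: eq_big_seq => -[s h]; rewrite mem_pairs !mem_int_box => /andP[sB _].
rewrite big_allpairs (bigD1_seq 0) ?int_box_uniq ?mem_int_box //=.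
rewrite [X in _ + X]big1 ?addr0 => [|u u0]; last first.
  by rewrite big1 // => v _; rewrite (negPf u0) if_same.
case: ifP => [/and5P[os oh s0 h0 /eqP sh]|not_split].
  rewrite -[RHS]count_even_lt //; last by lia.
  rewrite [RHS]big_mkcond; apply: eq_bigr => v _.
  rewrite s0 os oh h0 sh mul0r mulr0 addr0 subr0 !eqxx /= andbT.
  by case: (oddz v) => //=; case: ifP.
rewrite big1 // => v _; case: ifP => // /and5P[s0 os oh _ /eqP sh].
case: (_ && _) / andP => // -[h0 vs]; rewrite mul0r mulr0 addr0 in sh.
by rewrite s0 h0 os oh sh eqxx in not_split.
Qed.
End Bases.

(* As [(u + v) ^+ 2 - (v - u) ^+ 2 = 4 * (u * v)], the reduced bases with [u + v = w]
   correspond to [cone (2 * m - w ^+ 2)] by [r = v - u]. *)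
Definition cone (n : int) (x : triple) : bool := let: (r, (s, h)) := x in
  [&& oddz s, oddz h, ~~ oddz r, (`|r| < s) && (`|r| < h)
    & 2 * (s * h) - r ^+ 2 == n].

Definition cone_count (n : int) : int := \sum_(x <- box3 | cone n x) 1.

Lemma cone_lt n r s h : cone n (r, (s, h)) -> [/\ 0 < s, 0 < h & s * h < n].
Proof.
move=> /and5P[_ _ _ /andP[rs rh] /eqP <-].
have : r ^+ 2 < s * h by rewrite -real_normK ?num_real // expr2 ltr_pM.
by split; lia.
Qed.

Lemma nbasis_reduced_cone m : 2 * m <= B%:Z ->
  nbasis m reduced = \sum_(w <- box | ~~ oddz w) cone_count (2 * m - w ^+ 2).
Proof.
move=> m_box; transitivity (\sum_(y <- pairs box box3 |
    ~~ oddz y.1 && cone (2 * m - y.1 ^+ 2) y.2) 1 : int); last first.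
  rewrite big_mkcond big_allpairs [RHS]big_mkcond; apply: eq_bigr => w _ /=.
  by case: (oddz w) => /=; [rewrite big1 | rewrite -big_mkcond].
pose f (x : quadruple) := (x.2.1 + x.2.2, (x.2.2 - x.2.1, x.1)).
pose g (y : int * triple) :=
  (y.2.2, (((y.1 - y.2.1) %/ 2)%Z, ((y.1 + y.2.1) %/ 2)%Z)).
rewrite nbasisE; apply: (sum_bij (f := f) (g := g)).
- exact: box4_uniq.
- by rewrite pairs_uniq ?int_box_uniq.
- by move=> x /andP[bx rx] _; apply: reduced_box bx rx; lia.
- move=> [w [r [s h]]] /andP[_ cx] _; have [s0 h0 sh] := cone_lt cx.
  move: cx => /and5P[_ _ _ /andP[rs rh] _]; rewrite /= in sh.
  have := ler_mul_int s0 h0; have := ler_abs_sqr w.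
  by rewrite !mem_pairs !mem_int_box; lia.
- move=> [[s h] [u v]]; rewrite /basis /reduced /cone /oddz /f /g /= => bx.
  by split=> //; [lia | congr (_, (_, _)); lia].
- move=> [w [r [s h]]] /andP[/evenzP[i /= wE]].
  move=> /and5P[os oh /evenzP[j rE] /andP[rs rh] /eqP E].
  rewrite wE rE in rs rh E *; rewrite /g /f /= -mulrBr -mulrDr !mulKz //; split.
    by rewrite /basis /reduced; rewrite /oddz in os oh *; lia.
  by congr (_, (_, _)); ring.
Qed.

Lemma ternary_count_le0 n : n <= 0 -> ternary_count n = 0.
Proof.
move=> n0; rewrite /ternary_count big1 // => x ox; rewrite big1 // => y _.
rewrite big1 // => z _; case: eqP => //.
by have := oddz_sqr_ge1 ox; have := sqr_ge0 y; have := sqr_ge0 z; lia.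
Qed.

Lemma cone_count_le0 n : n <= 0 -> cone_count n = 0.
Proof.
move=> n0; rewrite /cone_count big1 // => -[r [s h]] /cone_lt[s0 h0 sh].
by have := mulr_gt0 s0 h0; lia.
Qed.

Lemma cone_count_gt0 k : 0 < k -> oddz k -> k <= B%:Z -> 0 < cone_count (2 * k).
Proof.
move=> k0 ok kB; rewrite /cone_count big_mkcond (bigD1_seq (0, (1, k))) //=; last first.
  by rewrite !mem_pairs !mem_int_box; lia.
rewrite ifT; last by rewrite /cone ok; lia.
by apply: ltr_pwDl => //; apply: sumr_ge0 => x _; case: ifP.
Qed.

Lemma sum_ternary_cone_eq0 k : oddz k -> 4 * k + 1 <= B%:Z -> 0 < k ->
  \sum_(w <- box | ~~ oddz w)
    (ternary_count (2 * k - w ^+ 2) - 4 * cone_count (2 * k - w ^+ 2)) = 0.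
Proof.
move=> ok k_box k0; rewrite sumrB -mulr_sumr -nbasis_reduced_cone; last by lia.
rewrite nbasis_reduced ?nbasis_triangular //; try lia.
have four0 : 4 != 0 :> int by [].
apply: (mulfI four0); rewrite mulrBr mulr0 -square_sum_count4_ternary; last by lia.
by rewrite -(gtz0_abs k0) square_sum_count4_odd_sigma; [ring | lia].
Qed.

Lemma ternary_count_cone k : oddz k -> 4 * k + 1 <= B%:Z -> 0 < k ->
  ternary_count (2 * k) = 4 * cone_count (2 * k).
Proof.
move=> + + k0; rewrite -(gtz0_abs k0); elim/ltn_ind: `|k|%N => {k k0} k IHk ok k_box.
have [->|k0] := posnP k; first by rewrite ternary_count_le0 ?cone_count_le0.
have := sum_ternary_cone_eq0 ok k_box k0.
rewrite -big_filter (bigD1_seq 0) /=; first last.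
- by rewrite filter_uniq ?int_box_uniq.
- by rewrite mem_filter mem_int_box.
rewrite expr0n subr0 big_filter_cond big1 ?addr0 => [/subr0_eq //|w].
move=> /andP[/evenzP[j wE] w0].
have j0 : 0 < j ^+ 2 by rewrite exprn_even_gt0 //; apply: contraNneq w0 => j0; lia.
have -> : 2 * k%:Z - w ^+ 2 = 2 * (k%:Z - 2 * j ^+ 2) by rewrite wE; ring.
have [kj|kj] := lerP (k%:Z - 2 * j ^+ 2) 0.
  by rewrite ternary_count_le0 ?cone_count_le0 ?mulr0 ?subr0 //; lia.
by rewrite -(gtz0_abs kj) IHk ?subrr //; rewrite /oddz in ok *; lia.
Qed.
End Box.

Theorem odd_double_three_squares k : 0 < k -> oddz k -> exists x y z : int,
  [/\ oddz x, oddz y, ~~ oddz z & x ^+ 2 + y ^+ 2 + z ^+ 2 = 2 * k].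
Proof.
move=> k0 ok; pose B := `|(4 * k + 1)%R|%N.
have /negP : ternary_count B (2 * k) != 0.
  by rewrite ternary_count_cone ?mulf_eq0 //= ?gt_eqF // ?cone_count_gt0 // /B; lia.
apply: contra_notP => no_rep; apply/eqP/big1 => x ox; apply: big1 => y oy.
by apply: big1 => z oz; case: eqP => // E; case: no_rep; exists x, y, z.
Qed.

(** * Distance graphs of integer lattices *)

Definition sqnorm n (v : 'rV[int]_n) : int := \sum_(i < n) v ord0 i ^+ 2.

Lemma edist_intr (R : realType) n (p q : 'rV[int]_n) :
  edist (map_mx intr p) (map_mx intr q) = Num.sqrt (sqnorm (p - q))%:~R :> R.
Proof.
rewrite /edist /sqnorm rmorph_sum; congr Num.sqrt; apply: eq_bigr => i _.
by rewrite !mxE rmorphXn rmorphB.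
Qed.

Lemma edist_intr_sqrt (R : realType) n (p q : 'rV[int]_n) (N : nat) :
  edist (map_mx intr p) (map_mx intr q) = Num.sqrt (N%:R : R) <-> sqnorm (p - q) = N.
Proof.
have norm_ge0 : 0 <= (sqnorm (p - q))%:~R :> R.
  by rewrite ler0z sumr_ge0 // => i _; apply: sqr_ge0.
rewrite edist_intr; split=> [E|->]; last by rewrite pmulrn.
apply/eqP; rewrite -(eqr_int R) -pmulrn -(sqr_sqrtr norm_ge0) E.
by rewrite sqr_sqrtr.
Qed.

Lemma colorable_int_lattice (R : realType) n (N k : nat) :
  colorable (dist_graph (int_lattice R n) (Num.sqrt N%:R)) k <->
  exists c : 'rV[int]_n -> 'I_k, forall p q, sqnorm (p - q) = N -> c p <> c q.
Proof.
split=> [[c cP]|[c cP]].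
  have lattice p : map_mx intr p \in int_lattice R n.
    by apply/mem_set => i; rewrite mxE intr_int.
  exists (fun p => c (SigSub (lattice p))) => p q pq; apply: cP.
  exact/edist_intr_sqrt.
pose coords (a : set_type (int_lattice R n)) : 'rV[int]_n := map_mx Num.floor (val a).
have coordsE a : val a = map_mx intr (coords a).
  by apply/rowP => i; rewrite !mxE floorK //; have := set_valP a; apply.
exists (c \o coords) => a b /=; rewrite (coordsE a) (coordsE b).
by move=> /edist_intr_sqrt /cP.
Qed.

Lemma Z3_sum_neq0 (x y z : 'Z_3) : x ^+ 2 + y ^+ 2 + z ^+ 2 = 1 -> x + y + z != 0.
Proof.
by case: x y z => [[|[|[|//]]] ?] [[|[|[|//]]] ?] [[|[|[|//]]] ?] /(congr1 val).
Qed.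

Lemma colorable3_int_lattice3 (R : realType) (N : nat) : N = 1 %[mod 3] ->
  colorable (dist_graph (int_lattice R 3) (Num.sqrt N%:R)) 3.
Proof.
move=> N1; apply/colorable_int_lattice.
pose c (p : 'rV[int]_3) : 'Z_3 := (\sum_(i < 3) p ord0 i)%:~R.
exists c => p q pq cpq; have norm1 : (sqnorm (p - q))%:~R = 1 :> 'Z_3.
  by rewrite pq; apply: val_inj; rewrite /= val_Zp_nat.
have /eqP[] : (\sum_(i < 3) (p - q) ord0 i)%:~R != 0 :> 'Z_3.
  move: norm1; rewrite /sqnorm !rmorph_sum /= !big_ord_recr !big_ord0 /= !add0r.
  by rewrite !rmorphXn /=; apply: Z3_sum_neq0.
by under eq_bigr do rewrite !mxE; rewrite sumrB rmorphB /= -/(c p) -/(c q) cpq subrr.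
Qed.

Section Shifts.
Variables (V : zmodType) (b : V -> bool).

Definition shifts (e : bool) (t : V) : Prop := forall p, b (p + t) = e (+) b p.

Lemma shifts0 : shifts false 0. Proof. by move=> p; rewrite addr0. Qed.

Lemma shiftsD e1 e2 t1 t2 :
  shifts e1 t1 -> shifts e2 t2 -> shifts (e1 (+) e2) (t1 + t2).
Proof. by move=> s1 s2 p; rewrite addrA s2 s1 addbCA addbA. Qed.

Lemma shiftsN e t : shifts e t -> shifts e (- t).
Proof. by move=> st p; rewrite -{2}(subrK t p) st addbA addbb. Qed.

Lemma shiftsMz e t n : shifts e t -> shifts (e && oddz n) (t *~ n).
Proof.
move=> st; have shiftsMn (k : nat) : shifts (e && odd k) (t *+ k).
  elim: k => [|k IHk]; first by rewrite andbF; apply: shifts0.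
  by rewrite mulrS /=; case: e st IHk => st IHk; apply: (shiftsD st IHk).
by case: n => n; [exact: shiftsMn | exact/shiftsN/shiftsMn].
Qed.

Lemma shifts_unique e1 e2 t : shifts e1 t -> shifts e2 t -> e1 = e2.
Proof. by move=> s1 s2; apply: (@addIb (b 0)); rewrite -s1 -s2. Qed.
End Shifts.

Definition row3 (x y z : int) : 'rV[int]_3 := \row_i [:: x; y; z]`_i.

Lemma sqnorm_row3 x y z : sqnorm (row3 x y z) = x ^+ 2 + y ^+ 2 + z ^+ 2.
Proof. by rewrite /sqnorm !big_ord_recr big_ord0 !mxE /= add0r. Qed.

Lemma row3D x y z x' y' z' :
  row3 x y z + row3 x' y' z' = row3 (x + x') (y + y') (z + z').
Proof. by apply/rowP => -[[|[|[|//]]] ?]; rewrite !mxE. Qed.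

Lemma row3Mz x y z n : row3 x y z *~ n = row3 (n * x) (n * y) (n * z).
Proof. by apply/rowP => -[[|[|[|//]]] ?]; rewrite -scaler_int !mxE intz. Qed.

Lemma not_bicolorable_odd_coord (x y z : int) (b : 'rV[int]_3 -> bool) :
  oddz x -> ~~ oddz (x + y + z) ->
  ~ forall p q, sqnorm (p - q) = x ^+ 2 + y ^+ 2 + z ^+ 2 -> b p != b q.
Proof.
move=> ox exyz bP.
have step t1 t2 t3 : t1 ^+ 2 + t2 ^+ 2 + t3 ^+ 2 = x ^+ 2 + y ^+ 2 + z ^+ 2 ->
    shifts b true (row3 t1 t2 t3).
  move=> tE p; have := bP (p + row3 t1 t2 t3) p.
  by rewrite addrAC subrr add0r sqnorm_row3 => /(_ tE); case: (b _); case: (b _).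
have two_steps t t' : shifts b true t -> shifts b true t' -> shifts b false (t + t').
  exact: shiftsD.
pose s := x + y + z; have [j sE] : exists j, s = 2 * j by apply/evenzP.
have diag_s : shifts b true (row3 s s s).
  have -> : row3 s s s = row3 x y z + row3 y z x + row3 z x y.
    by rewrite !row3D; congr row3; rewrite /s; ring.
  by apply: (shiftsD (e1 := false)); [apply: two_steps | ]; apply: step; ring.
have diag_2x : shifts b false (row3 (2 * x) (2 * x) (2 * x)).
  have -> : row3 (2 * x) (2 * x) (2 * x) =
      (row3 x y z + row3 x (- y) (- z)) + (row3 y x z + row3 (- y) x (- z)) +
      (row3 y z x + row3 (- y) (- z) x).
    by rewrite !row3D; congr row3; ring.
  apply: (shiftsD (e1 := false) (e2 := false)).
    apply: (shiftsD (e1 := false) (e2 := false)).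
      by apply: two_steps; apply: step; ring.
    by apply: two_steps; apply: step; ring.
  by apply: two_steps; apply: step; ring.
have := shifts_unique (shiftsMz x diag_s) (_ : shifts b false _); rewrite ox.
have -> : row3 s s s *~ x = row3 (2 * x) (2 * x) (2 * x) *~ j.
  by rewrite !row3Mz sE; congr row3; ring.
by move=> /(_ (shiftsMz j diag_2x)).
Qed.

Theorem theorem1 (R : realType) (d : nat) (d_gt0 : (0 < d)%N)
    (d_odd : odd d) (d_mod3 : d = 2 %[mod 3]) :
  is_chromatic_number
    (dist_graph (int_lattice R 3) (Num.sqrt ((2 * d)%N%:R : R))) 3.
Proof.
split; first by apply: colorable3_int_lattice3; rewrite -modnMmr d_mod3.
move=> m /colorable_int_lattice[c cP]; rewrite leqNgt; apply/negP => m_lt3.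
have [|x [y [z [ox oy oz xyz]]]] := @odd_double_three_squares d _ d_odd; first lia.
have even_sum : ~~ oddz (x + y + z).
  by move: ox oy oz; rewrite /oddz; lia.
apply: (not_bicolorable_odd_coord (b := fun p => c p == 0%N :> nat) ox even_sum) => p q.
rewrite xyz => /cP c_neq; apply/eqP => same; apply/c_neq/val_inj => /=.
by move: same (ltn_ord (c p)) (ltn_ord (c q)); lia.
Qed.
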